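(* For all integers $r,k\geq 2$, $$g\left(n,2kr,\binom{2kr}{2}-(r-1)2k+1\right)=\Omega\left(n^{\frac{r}{r-1}\cdot\frac{k-1}{k}}\right).$$
   Context: For positive integers $n,p$ and $2\leq q\leq\binom{p}{2}$, the Erdős–Gyárfás function $g(n,p,q)$ is the smallest number $c$ such that there is a (not necessarily proper) colouring of the edges of $K_n$ with $c$ colours in which every set of $p$ vertices induces a subgraph whose edges receive at least $q$ distinct colours. *)

(* Defs.v *)
From mathcomp Require Import all_boot.
From Stdlib Require Import Reals.
Set Implicit Arguments. Unset Strict Implicit. Unset Printing Implicit Defensive.

(* An edge colouring of K_n with (at most) c colours: the edge {x,y} with
   x < y receives colour col (x, y).  Values col (x, y) with x >= y are
   irrelevant. *)
Definition edge_colours (n c : nat) (col : {ffun 'I_n * 'I_n -> 'I_c})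
  (S : {set 'I_n}) : {set 'I_c} :=
  [set col (x, y) | x in S, y in S & (x < y)%N].

Definition good_colouring (n p q c : nat) : bool :=
  [exists col : {ffun 'I_n * 'I_n -> 'I_c},
     [forall S : {set 'I_n}, (#|S| == p) ==> (q <= #|edge_colours col S|)]].

(* Erdos-Gyarfas function g(n,p,q): the least c with a good colouring.
   Colouring every edge with its own colour ('C(n,2) colours) is always good
   when q <= 'C(p,2), so the least such c lies in [0, 'C(n,2)]; searching
   this range with [find] gives exactly the minimum. *)
Definition g (n p q : nat) : nat :=
  find (good_colouring n p q) (iota 0 ('C(n, 2)).+1).

(* Main.v *)
(* Suppose K_n is coloured with c colours as required.  A monochromatic star has
   boundedly many edges, since otherwise some p vertices would see too few
   colours.  Join two injective r-tuples X, Y of vertices when the r edges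
   {X_i, Y_i} have the same colour; a power-mean argument gives about
   n^(2r) / c^(r-1) such pairs.  A 2k-cycle in this "energy graph" whose tuples
   are pairwise vertex-disjoint spans p = 2kr vertices and 2kr edges with only
   2k colours, which is forbidden.

   Such a cycle is found with the counting method of Janzer.  Call two tuples
   similar when they share a vertex; each tuple V has boundedly many neighbours
   similar to a given tuple.  Passing to a subgraph of minimum degree delta,
   weight closed 2k-walks by the simple random walk.  The closed 2k-walks with a
   similar pair have total weight at most a constant times
   sqrt (s / delta * tr P^(2k) * tr P^(2k-2)), and log-convexity of
   j |-> tr P^(2j) together with tr P^(2k) >= 1 makes this smaller than
   tr P^(2k) as soon as delta exceeds a constant times N^(1/k), N = n^r being the
   number of tuples.  Using the random walk rather than counting walks makes an
   upper bound on the degrees unnecessary. *)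
Require Import Defs.
From mathcomp Require Import all_boot all_order all_algebra.
From mathcomp Require Import ring lra zify.
Set Implicit Arguments. Unset Strict Implicit. Unset Printing Implicit Defensive.
Import Order.TTheory GRing.Theory Num.Theory.

(** * Closed random walks and cycles without similar vertices *)

Section RandomWalk.
Local Open Scope ring_scope.
Variables (F : realFieldType) (T : finType) (e : rel T).
Hypothesis e_sym : symmetric e.

Definition deg (x : T) : nat := #|[pred y | e x y]|.
(** At an isolated vertex this is 0/0, read as 0: the walk dies there, and the row of [x] sums to 1
    exactly when [x] has positive degree. *)
Definition step (x y : T) : F := (e x y)%:R / (deg x)%:R.

(** The argument of [G] lists the vertices visited after the start [x], so an [n]-step walk is a
    list of size [n]. *)
Fixpoint walk_sum n x (G : seq T -> F) : F :=
  if n is m.+1 then \sum_y step x y * walk_sum m y (fun q => G (y :: q))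
  else G [::].

Definition trans n x y : F := walk_sum n x (fun q => (last x q == y)%:R).

(** The trace of P^n, where P is the transition matrix [step]. *)
Definition return_sum n : F := \sum_x trans n x x.

(** The start [x] is recorded only as the last entry of [q], so [q] lists every position of the
    closed walk once and can be rotated. *)
Definition closed_sum n (G : seq T -> F) : F :=
  \sum_x walk_sum n x (fun q => (last x q == x)%:R * G q).

Lemma step_ge0 x y : 0 <= step x y.
Proof. by rewrite divr_ge0 ?ler0n. Qed.

Lemma walk_sum_le n x G H :
  (forall q, size q = n -> path e x q -> G q <= H q) ->
  walk_sum n x G <= walk_sum n x H.
Proof.
elim: n x G H => [|n IHn] x G H leGH /=; first exact: leGH.
apply: ler_sum => y _; have [exy|nexy] := boolP (e x y).
  rewrite ler_wpM2l ?step_ge0 ?IHn // => q sq pq.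
  by apply: leGH; rewrite /= ?sq ?exy.
by rewrite /step (negPf nexy) !mul0r.
Qed.

Lemma eq_walk_sum n x G H :
  (forall q, size q = n -> path e x q -> G q = H q) ->
  walk_sum n x G = walk_sum n x H.
Proof. by move=> eqGH; apply/le_anti/andP; split; apply: walk_sum_le => q sq pq; rewrite eqGH. Qed.

Lemma walk_sum_sum n x (I : finType) (G : I -> seq T -> F) :
  walk_sum n x (fun q => \sum_i G i q) = \sum_i walk_sum n x (G i).
Proof.
elim: n x G => [|n IHn] x G //=.
rewrite exchange_big; apply: eq_bigr => y _ /=.
by rewrite -mulr_sumr IHn.
Qed.

Lemma walk_sumZ n x c G : walk_sum n x (fun q => c * G q) = c * walk_sum n x G.
Proof.
elim: n x G => [|n IHn] x G //=.
by rewrite mulr_sumr; apply: eq_bigr => y _; rewrite IHn mulrCA.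
Qed.

Lemma walk_sum_ge0 n x G : (forall q, 0 <= G q) -> 0 <= walk_sum n x G.
Proof.
elim: n x G => [|n IHn] x G G0 //=.
by apply: sumr_ge0 => y _; rewrite mulr_ge0 ?step_ge0 ?IHn.
Qed.

Lemma walk_sum_cat m n x G :
  walk_sum (m + n) x G =
  walk_sum m x (fun q => walk_sum n (last x q) (fun q' => G (q ++ q'))).
Proof. by elim: m x G => [|m IHm] x G //=; apply: eq_bigr => y _; rewrite IHm. Qed.

Lemma trans_ge0 n x y : 0 <= trans n x y.
Proof. by apply: walk_sum_ge0 => q; rewrite ler0n. Qed.

Lemma sum_pred1 (G : T -> F) y : \sum_z (y == z)%:R * G z = G y.
Proof.
rewrite (bigD1 y) //= eqxx mul1r big1 ?addr0 // => z /negPf zy.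
by rewrite eq_sym zy mul0r.
Qed.

Lemma walk_sum_last n x (G : T -> F) :
  walk_sum n x (fun q => G (last x q)) = \sum_y trans n x y * G y.
Proof.
transitivity (walk_sum n x (fun q => \sum_y G y * (last x q == y)%:R)).
  apply: eq_walk_sum => q _ _; rewrite -(sum_pred1 G).
  by apply: eq_bigr => y _; rewrite mulrC.
by rewrite walk_sum_sum; apply: eq_bigr => y _; rewrite walk_sumZ mulrC.
Qed.

Lemma transS n x y : trans n.+1 x y = \sum_z step x z * trans n z y.
Proof. by []. Qed.

Lemma trans_add m n x y : trans (m + n) x y = \sum_z trans m x z * trans n z y.
Proof.
rewrite /trans walk_sum_cat -walk_sum_last; apply: eq_walk_sum => q _ _.
by apply: eq_walk_sum => q' _ _; rewrite last_cat.
Qed.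

Lemma transSr n x y : trans n.+1 x y = \sum_z trans n x z * step z y.
Proof.
rewrite -addn1 trans_add; apply: eq_bigr => z _; congr (_ * _).
rewrite transS -(sum_pred1 (step z) y); apply: eq_bigr => w _.
by rewrite mulrC /trans /= eq_sym.
Qed.

Lemma return_sum_add m n :
  return_sum (m + n) = \sum_x \sum_y trans m x y * trans n y x.
Proof. by apply: eq_bigr => x _; rewrite trans_add. Qed.

Lemma deg_step x y : (deg x)%:R * step x y = (e x y)%:R.
Proof.
rewrite /step; have [d0|d0] := eqVneq (deg x) 0%N; last by rewrite mulrC divfK ?pnatr_eq0.
rewrite d0 mul0r; case exy: (e x y) => //.
by have := card0_eq d0 y; rewrite !inE exy.
Qed.

(** Detailed balance: [deg x * step x y] is the symmetric quantity [e x y], and the degree factor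
    moves along the walk one step at a time. *)
Lemma trans_reversible n x y :
  (deg x)%:R * trans n x y = (deg y)%:R * trans n y x.
Proof.
elim: n x y => [|n IHn] x y.
  by rewrite /trans /= eq_sym; case: eqVneq => [->|] //; rewrite !mulr0.
rewrite transS transSr !mulr_sumr; apply: eq_bigr => z _.
by rewrite mulrA deg_step e_sym -deg_step mulrAC IHn mulrA.
Qed.

Lemma trans_deg0 n x y : deg x = 0%N -> trans n x y = ((n == 0%N) && (x == y))%:R.
Proof.
case: n => [//|n] dx; rewrite transS /= big1 // => z _.
by rewrite /step dx invr0 mulr0 mul0r.
Qed.

Lemma sum_adj x : (\sum_y e x y)%N = deg x.
Proof.
by rewrite /deg -sum1_card [RHS]big_mkcond; apply: eq_bigr => y _; rewrite inE; case: (e x y).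
Qed.

Lemma step_sum_le1 x : \sum_y step x y <= 1.
Proof.
rewrite -mulr_suml -natr_sum sum_adj.
have [->|d0] := eqVneq (deg x) 0%N; first by rewrite mul0r.
by rewrite divff ?pnatr_eq0.
Qed.

(** Every step ends at a vertex of positive degree, so no mass is lost; the factor [deg x] covers
    isolated [x]. *)
Lemma deg_trans_sum n x : (deg x)%:R * (\sum_y trans n x y) = (deg x)%:R.
Proof.
elim: n x => [|n IHn] x.
  rewrite (eq_bigr (fun y => (x == y)%:R * 1)); first by rewrite sum_pred1 mulr1.
  by move=> y _; rewrite mulr1.
under eq_bigr do rewrite transS.
rewrite exchange_big mulr_sumr /=.
transitivity (\sum_z (e x z)%:R : F).
  apply: eq_bigr => z _; rewrite -mulr_sumr mulrA deg_step e_sym -deg_step.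
  by rewrite mulrAC IHn deg_step.
by rewrite -natr_sum sum_adj.
Qed.

(** Replaces the spectral theorem: between vertices of positive degree, balance gives [U x y] and
    [U y x] the same sign, so the trace of U^2 is a sum of nonnegative terms. Between two isolated
    vertices balance says nothing, hence the second hypothesis. *)
Lemma balanced_mul_ge0 (U : T -> T -> F) x y :
  (deg x)%:R * U x y = (deg y)%:R * U y x ->
  (deg x = 0%N -> deg y = 0%N -> x != y -> U x y = 0) ->
  0 <= U x y * U y x.
Proof.
move=> bal U0; have [->|xy] := eqVneq x y; first exact: sqr_ge0.
have [dx|dx] := posnP (deg x); have [dy|dy] := posnP (deg y).
- by rewrite U0 // mul0r.
- move: bal; rewrite dx mul0r => /esym/eqP; rewrite mulf_eq0 pnatr_eq0 gtn_eqF //=.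
  by move/eqP->; rewrite mulr0.
- move: bal; rewrite dy mul0r => /eqP; rewrite mulf_eq0 pnatr_eq0 gtn_eqF //=.
  by move/eqP->; rewrite mul0r.
have d0 : 0 < (deg y)%:R :> F by rewrite ltr0n.
rewrite -(pmulr_rge0 _ d0) mulrCA -bal mulrCA mulr_ge0 ?ler0n //.
exact: sqr_ge0.
Qed.

(** Subtracting from P^n the stationary projection, with entries [deg y / D], leaves a reversible
    [U] whose square has trace tr P^(2n) - 1. *)
Lemma return_sum_ge1 n : (exists x y, e x y) -> 1 <= return_sum (n + n).
Proof.
move=> [a [b eab]]; pose D : F := \sum_x (deg x)%:R.
have D0 : 0 < D.
  rewrite /D (bigD1 a) //= ltr_wpDr ?sumr_ge0 // ltr0n.
  by apply/card_gt0P; exists b.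
pose U x y : F := trans n x y - D^-1 * (deg y)%:R.
have U_ge0 : 0 <= \sum_x \sum_y U x y * U y x.
  apply: sumr_ge0 => x _; apply: sumr_ge0 => y _; apply: balanced_mul_ge0.
    by rewrite /U !mulrBr trans_reversible; congr (_ - _); ring.
  by move=> dx dy /negPf xy; rewrite /U (trans_deg0 _ _ dx) xy andbF dy mulr0 subr0.
have sumD : \sum_x \sum_y (deg x)%:R * trans n x y = D.
  by apply: eq_bigr => x _; rewrite -mulr_sumr deg_trans_sum.
suff E : \sum_x \sum_y U x y * U y x = return_sum (n + n) - 1 by rewrite -subr_ge0 -E.
rewrite return_sum_add.
transitivity (\sum_x \sum_y trans n x y * trans n y x
   - D^-1 * (\sum_x \sum_y (deg x)%:R * trans n x y)
   - D^-1 * (\sum_x \sum_y (deg y)%:R * trans n y x)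
   + D^-1 * D^-1 * (\sum_x \sum_y (deg x)%:R * (deg y)%:R)).
  rewrite !mulr_sumr -!sumrB -big_split /=; apply: eq_bigr => x _.
  rewrite !mulr_sumr -!sumrB -big_split /=; apply: eq_bigr => y _.
  by rewrite /U; ring.
rewrite sumD exchange_big /= [X in _ - _ * X]exchange_big /= sumD.
have -> : \sum_x \sum_y (deg x)%:R * (deg y)%:R = D * D.
  by rewrite mulr_suml; apply: eq_bigr => x _; rewrite mulr_sumr.
rewrite exchange_big /=; have : D != 0 by rewrite gt_eqF.
by move=> ?; field.
Qed.

(** This is tr U^2 >= 0 for U = rho P^j - P^(j+2), a quadratic form of log-convexity. *)
Lemma return_sum_convex (rho : F) j :
  2%:R * rho * return_sum (j.+1 + j.+1) <=
  rho ^+ 2 * return_sum (j + j) + return_sum (j.+2 + j.+2).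
Proof.
pose U x y : F := rho * trans j x y - trans j.+2 x y.
have U_ge0 : 0 <= \sum_x \sum_y U x y * U y x.
  apply: sumr_ge0 => x _; apply: sumr_ge0 => y _; apply: balanced_mul_ge0.
    by rewrite /U !mulrBr mulrCA trans_reversible mulrCA; congr (_ - _); apply: trans_reversible.
  by move=> dx dy /negPf xy; rewrite /U !(trans_deg0 _ _ dx) xy !andbF mulr0 subr0.
have E : return_sum (j.+1 + j.+1) = \sum_x \sum_y trans j x y * trans j.+2 y x.
  by rewrite -return_sum_add addSnnS.
have E' : return_sum (j.+1 + j.+1) = \sum_x \sum_y trans j.+2 x y * trans j y x.
  by rewrite -return_sum_add addSnnS addnC.
suff : \sum_x \sum_y U x y * U y x =
   rho ^+ 2 * return_sum (j + j) + return_sum (j.+2 + j.+2)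
   - 2%:R * rho * return_sum (j.+1 + j.+1) by move=> h; rewrite -subr_ge0 -h.
rewrite -mulrA mulr_natl mulr2n {1}E E' !return_sum_add.
rewrite -mulrDr -!big_split !mulr_sumr -big_split -sumrB /=; apply: eq_bigr => x _.
rewrite -!big_split !mulr_sumr -big_split -sumrB /=; apply: eq_bigr => y _.
by rewrite /U; ring.
Qed.

Lemma return_sum0 : return_sum 0 = #|T|%:R.
Proof.
rewrite /return_sum (eq_bigr (fun _ => 1)); first by rewrite sumr_const.
by move=> x _; rewrite /trans /= eqxx.
Qed.

(** If the ratio were below [rho] at [k], convexity would push it below [rho] at every smaller
    index. Multiplying these ratios down to tr P^0 = [#|T|] would give tr P^(2k+2) < 1. *)
Lemma return_sum_ratio (rho : F) k : (exists x y, e x y) ->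
  0 < rho -> rho ^+ k.+1 * #|T|%:R <= 1 ->
  rho * return_sum (k + k) <= return_sum (k.+1 + k.+1).
Proof.
move=> edge rho0 rhoT; rewrite leNgt; apply/negP => lt.
suff : return_sum (k.+1 + k.+1) < rho ^+ k.+1 * #|T|%:R.
  by move/lt_le_trans/(_ rhoT); rewrite ltNge return_sum_ge1.
elim: {rhoT} k lt => [|k IHk] lt; first by rewrite expr1 -return_sum0.
have lt' : return_sum (k.+1 + k.+1) < rho * return_sum (k + k).
  have := return_sum_convex rho k.
  rewrite -(ltr_pM2l rho0) => conv.
  rewrite mulrA -expr2; lra.
apply: lt_trans lt _; rewrite exprS -mulrA ltr_pM2l //; exact: IHk.
Qed.

(** * Sums over closed walks and their rotations *)

Lemma closed_sum1 n : closed_sum n (fun=> 1) = return_sum n.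
Proof. by apply: eq_bigr => x _; apply: eq_walk_sum => q _ _; rewrite mulr1. Qed.

Lemma closed_sum_le n G H :
  (forall q, size q = n -> cycle e q -> G q <= H q) ->
  closed_sum n G <= closed_sum n H.
Proof.
move=> le; apply: ler_sum => x _; apply: walk_sum_le => q sq pq.
case: eqP => [lq|]; last by rewrite !mul0r.
rewrite !mul1r le //; case: q {sq} pq lq => [//|y q] /= /andP[exy pq] lq.
by rewrite rcons_path pq lq.
Qed.

Lemma closed_sum_sum n (I : finType) (G : I -> seq T -> F) :
  closed_sum n (fun q => \sum_i G i q) = \sum_i closed_sum n (G i).
Proof.
rewrite exchange_big; apply: eq_bigr => x _ /=; rewrite -walk_sum_sum.
by apply: eq_walk_sum => q _ _; rewrite mulr_sumr.
Qed.

(** The weight of a closed walk is a product around the cycle: peeling off the first step and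
    peeling off the last step give the same sum. *)
Lemma closed_sum_rot1 n G : closed_sum n (fun q => G (rot 1 q)) = closed_sum n G.
Proof.
case: n => [//|n].
transitivity (\sum_y walk_sum n y (fun q => step (last y q) y * G (rcons q y))).
  rewrite /closed_sum /= exchange_big; apply: eq_bigr => y _ /=.
  under eq_bigr do rewrite -walk_sumZ.
  rewrite -walk_sum_sum; apply: eq_walk_sum => q _ _.
  rewrite -(sum_pred1 (fun z => step z y * G (rcons q y))); apply: eq_bigr => z _.
  by rewrite rot1_cons mulrCA.
apply: eq_bigr => y _; rewrite -addn1 walk_sum_cat; apply: eq_walk_sum => q _ _ /=.
rewrite -(sum_pred1 (fun z => step (last y q) z * G (rcons q z))); apply: eq_bigr => z _.
by rewrite last_cat /= eq_sym cats1 mulrCA.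
Qed.

Lemma closed_sum_rot a n G : (a <= n)%N ->
  closed_sum n (fun q => G (rot a q)) = closed_sum n G.
Proof.
elim: a => [|a IHa] an.
  by apply: eq_bigr => x _; apply: eq_walk_sum => q _ _; rewrite rot0.
rewrite -IHa ?(ltnW an) // -[RHS]closed_sum_rot1.
apply: eq_bigr => x _; apply: eq_walk_sum => q sq _.
by rewrite rotS ?sq // rot_rot.
Qed.

(** * Closed walks with a similar pair *)

Variables (sim : rel T) (s delta : nat).
Hypothesis sim_sym : symmetric sim.
Hypothesis sim_bound : forall u v, (#|[pred w | e v w && sim u w]| <= s)%N.
Hypothesis delta_gt0 : (0 < delta)%N.
Hypothesis min_deg : forall x y, e x y -> (delta <= deg x)%N.

Lemma step_sim_sum x z : \sum_y step x y * (sim y z)%:R <= s%:R / delta%:R.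
Proof.
apply: le_trans (_ : \sum_y (e x y && sim z y)%:R / delta%:R <= _).
  apply: ler_sum => y _; rewrite /step sim_sym; case exy: (e x y); last by rewrite !mul0r.
  case: (sim z y); last by rewrite mulr0 mul0r.
  rewrite !mul1r mulr1 lef_pV2 ?posrE ?ltr0n ?ler_nat ?(min_deg exy) //.
  exact: leq_trans (min_deg exy).
rewrite -mulr_suml ler_wpM2r ?invr_ge0 ?ler0n // -natr_sum ler_nat.
apply: leq_trans (sim_bound z x); rewrite -sum1_card [leqRHS]big_mkcond.
by apply: leq_sum => y _; rewrite inE; case: (_ && _).
Qed.

(* Write the closed walk as x, y, a walk of length m from y to u, and a walk of
   length m.+1 from u back to x that contains a vertex similar to y.  When
   tau * trans m y u <= trans m.+1 x u, enumerate the long walk first: y then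
   has at most s choices.  Otherwise drop the similarity and use reversibility
   to replace the long walk by one of length m. *)
Lemma closed_sum_sim (x0 : T) (tau : F) m i : 0 < tau -> (i <= m)%N ->
  closed_sum (m.+1 + m.+1)
    (fun q => (sim (nth x0 q 0) (nth x0 q (m.+1 + i)))%:R) <=
  s%:R / delta%:R / tau * return_sum (m.+1 + m.+1) + tau * return_sum (m + m).
Proof.
move=> tau0 im.
pose W u x y := walk_sum m.+1 u
  (fun q => (last u q == x)%:R * (sim y (nth x0 q i))%:R).
have W_ge0 u x y : 0 <= W u x y.
  by apply: walk_sum_ge0 => q; rewrite -natrM ler0n.
have W_le u x y : W u x y <= trans m.+1 u x.
  apply: walk_sum_le => q _ _; rewrite -natrM ler_nat.
  by case: (_ == _); case: (sim _ _).
have -> : closed_sum (m.+1 + m.+1)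
    (fun q => (sim (nth x0 q 0) (nth x0 q (m.+1 + i)))%:R) =
    \sum_x \sum_y \sum_u step x y * (trans m y u * W u x y).
  apply: eq_bigr => x _; rewrite addSn; apply: eq_bigr => y _.
  rewrite -mulr_sumr; congr (_ * _).
  rewrite -/(walk_sum _ _ _) walk_sum_cat -(walk_sum_last m y (fun u => W u x y)).
  apply: eq_walk_sum => q sq _; apply: eq_walk_sum => q' _ _ /=.
  by rewrite last_cat nth_cat sq ltnNge leq_addr addKn.
pose A x y u := tau^-1 * (trans m.+1 x u * (step x y * W u x y)).
pose B x y u := tau * (step y x * (trans m y u * trans m u y)).
apply: le_trans (_ : \sum_x \sum_y \sum_u (A x y u + B x y u) <= _).
  apply: ler_sum => x _; apply: ler_sum => y _; apply: ler_sum => u _.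
  have A0 : 0 <= A x y u.
    by do !apply: mulr_ge0; rewrite ?invr_ge0 ?(ltW tau0) ?trans_ge0 ?ler0n.
  have B0 : 0 <= B x y u.
    by do !apply: mulr_ge0; rewrite ?invr_ge0 ?(ltW tau0) ?trans_ge0 ?ler0n.
  have [le|gt] := leP (tau * trans m y u) (trans m.+1 x u).
    apply: le_trans (_ : A x y u <= _); last by rewrite lerDl.
    have -> : A x y u = step x y * (trans m.+1 x u / tau * W u x y).
      by rewrite /A; ring.
    rewrite ler_wpM2l ?step_ge0 // ler_wpM2r //.
    by rewrite ler_pdivlMr // mulrC.
  apply: le_trans (_ : B x y u <= _); last by rewrite lerDr.
  apply: le_trans (_ : step x y * (trans m y u * trans m.+1 u x) <= _).
    by rewrite ler_wpM2l ?step_ge0 // ler_wpM2l ?trans_ge0.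
  (* Reversibility can only be used after multiplying by a nonzero [deg u]; if [u] is isolated, a
     walk of positive length from it has weight 0. *)
  have [du|du] := posnP (deg u).
    by rewrite (trans_deg0 _ _ du) /= !mulr0.
  have du0 : 0 < (deg u)%:R :> F by rewrite ltr0n.
  have swapL : (deg u)%:R * (step x y * (trans m y u * trans m.+1 u x)) =
      (e x y)%:R * trans m y u * trans m.+1 x u.
    transitivity (step x y * trans m y u * ((deg u)%:R * trans m.+1 u x)); first by ring.
    by rewrite -trans_reversible -deg_step; ring.
  have swapR : (deg u)%:R * B x y u = (e x y)%:R * trans m y u * (tau * trans m y u).
    rewrite e_sym -deg_step.
    transitivity (tau * step y x * trans m y u * ((deg u)%:R * trans m u y)).
      by rewrite /B; ring.
    by rewrite -trans_reversible; ring.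
  by rewrite -(ler_pM2l du0) swapL swapR ler_wpM2l ?mulr_ge0 ?ler0n ?trans_ge0 ?ltW.
under eq_bigr do under eq_bigr do rewrite big_split.
under eq_bigr do rewrite big_split.
rewrite big_split /=; apply: lerD.
  rewrite -mulrA mulrCA return_sum_add !mulr_sumr; apply: ler_sum => x _.
  rewrite exchange_big !mulr_sumr; apply: ler_sum => u _ /=.
  rewrite -mulr_sumr ler_wpM2l ?invr_ge0 ?(ltW tau0) //.
  rewrite -mulr_sumr mulrCA ler_wpM2l ?trans_ge0 //.
  under eq_bigr do rewrite -walk_sumZ.
  rewrite -walk_sum_sum /trans -walk_sumZ; apply: walk_sum_le => q _ _.
  under eq_bigr do rewrite mulrCA.
  by rewrite -mulr_sumr mulrC ler_wpM2r ?ler0n ?step_sim_sum.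
(* In [B] the vertex [x] occurs only in [step y x], whose sum over [x] is at most 1; what remains is
   tr P^(2m). *)
rewrite return_sum_add mulr_sumr exchange_big; apply: ler_sum => y _ /=.
rewrite exchange_big mulr_sumr; apply: ler_sum => u _ /=.
rewrite -mulr_sumr ler_wpM2l ?(ltW tau0) // -mulr_suml.
by rewrite -[leRHS]mul1r ler_wpM2r ?mulr_ge0 ?trans_ge0 ?step_sum_le1.
Qed.

(** One of the two arcs between the similar positions has length at least [m.+1]; rotate to the
    start of that arc. *)
Lemma similar_pair_rot (x0 : T) m q : size q = (m.+1 + m.+1)%N ->
  ~~ pairwise (fun x y => ~~ sim x y) q ->
  exists (a : 'I_(m.+1 + m.+1)) (i : 'I_m.+1),
    sim (nth x0 (rot a q) 0) (nth x0 (rot a q) (m.+1 + i)).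
Proof.
move=> sq npq.
have [a [b [lt_ab b_q simab]]] : exists a b,
    [/\ (a < b)%N, (b < size q)%N & sim (nth x0 q a) (nth x0 q b)].
  have [/existsP[b /existsP[a sab]]|none] :=
      boolP [exists b : 'I_(size q), exists a : 'I_b, sim (nth x0 q a) (nth x0 q b)].
    by exists a, b; split.
  case/negP: npq; apply/(pairwiseP x0) => a b _; rewrite inE => b_q ab.
  apply: contra none => sab; apply/existsP; exists (Ordinal b_q).
  by apply/existsP; exists (Ordinal ab).
have a_q := ltn_trans lt_ab b_q.
have [ge|lt] := leqP m.+1 (b - a).
  have an : (a < m.+1 + m.+1)%N by rewrite -sq.
  have i_m : (b - a - m.+1 < m.+1)%N by lia.
  exists (Ordinal an), (Ordinal i_m) => /=.
  rewrite /rot !nth_cat size_drop !nth_drop addn0.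
  rewrite ifT; last by lia.
  rewrite ifT; last by lia.
  by have -> : (a + (m.+1 + (b - a - m.+1)))%N = b by lia.
have bn : (b < m.+1 + m.+1)%N by rewrite -sq.
have i_m : (m.+1 - (b - a) < m.+1)%N by lia.
exists (Ordinal bn), (Ordinal i_m) => /=.
rewrite sim_sym /rot !nth_cat size_drop !nth_drop addn0.
rewrite ifF; last by lia.
rewrite ifT; last by lia.
rewrite nth_take; last by lia.
by have -> : (m.+1 + (m.+1 - (b - a)) - (size q - b))%N = a by lia.
Qed.

Lemma nonsimilar_cycle_min_deg m : (exists x y, e x y) ->
  ((32 * m.+1 ^ 4 * s + 1) ^ m.+1 * #|T| <= delta ^ m.+1)%N ->
  exists q, [/\ size q = (m.+1 + m.+1)%N, cycle e q &
                pairwise (fun x y => ~~ sim x y) q].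
Proof.
move=> edge; have [x0 _] := edge.
have [c cE] : exists c, c = (32 * m.+1 ^ 4 * s + 1)%N by exists (32 * m.+1 ^ 4 * s + 1)%N.
rewrite -cE => large.
pose n := (m.+1 + m.+1)%N.
have [/existsP[q /andP[cq pq]]|none] :=
    boolP [exists q : n.-tuple T, cycle e q && pairwise (fun x y => ~~ sim x y) q].
  by exists q; rewrite size_tuple.
exfalso.
have delta0 : 0 < delta%:R :> F by rewrite ltr0n.
have c0 : 0 < c%:R :> F by rewrite ltr0n cE addn1.
pose rho : F := c%:R / delta%:R.
have rho0 : 0 < rho by rewrite divr_gt0.
have [k kE] : exists k : F, k = m.+1%:R by exists m.+1%:R.
have k0 : 0 < k by rewrite kE ltr0n.
(* With this [tau] the second error term is at most [rho / 4] times tr P^(2k-2), hence at most a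
   quarter of tr P^(2k). The first is 16 k^4 s / c times tr P^(2k), at most half of it. Together
   they stay below tr P^(2k). *)
pose tau : F := rho / (8%:R * k ^+ 2).
have tau0 : 0 < tau by rewrite divr_gt0 // mulr_gt0 ?exprn_gt0 // ltr0n.
have ratio : rho * return_sum (m + m) <= return_sum n.
  apply: return_sum_ratio => //.
  rewrite expr_div_n mulrAC ler_pdivrMr ?exprn_gt0 // mul1r.
  by rewrite -!natrX -natrM ler_nat.
have ge1 : 1 <= return_sum n by apply: return_sum_ge1.
have bound : return_sum n <= 2%:R * k * k *
   (s%:R / delta%:R / tau * return_sum n + tau * return_sum (m + m)).
  rewrite -[leLHS]closed_sum1.
  apply: le_trans (_ : closed_sum n (fun q => \sum_(a < n) \sum_(i < m.+1)
      (sim (nth x0 (rot a q) 0) (nth x0 (rot a q) (m.+1 + i)))%:R) <= _).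
    apply: closed_sum_le => q sq cq.
    have /(similar_pair_rot x0 sq)[a [i sai]] :
        ~~ pairwise (fun x y => ~~ sim x y) q.
      apply: contra none => pq; apply/existsP.
      by exists (tcast sq (in_tuple q)); rewrite val_tcast /= cq.
    rewrite (bigD1 a) //= (bigD1 i) //= sai -addrA ler_wpDr //.
    rewrite addr_ge0 // sumr_ge0 // => ? _; rewrite ?ler0n //.
    by rewrite sumr_ge0 // => ? _; rewrite ler0n.
  rewrite closed_sum_sum.
  apply: le_trans (_ : \sum_(a < n) \sum_(i < m.+1)
     (s%:R / delta%:R / tau * return_sum n + tau * return_sum (m + m)) <= _).
    apply: ler_sum => a _; rewrite closed_sum_sum; apply: ler_sum => i _.
    rewrite (closed_sum_rot (fun q => (sim (nth x0 q 0) (nth x0 q (m.+1 + i)))%:R));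
      last exact: ltnW (ltn_ord a).
    by apply: closed_sum_sim; rewrite // -ltnS.
  have nk : n%:R = k + k :> F by rewrite kE natrD.
  rewrite !sumr_const !card_ord -[leLHS]mulr_natr -[X in X * _ <= _]mulr_natr nk -kE.
  by rewrite le_eqVlt; apply/orP; left; apply/eqP; ring.
have k2 : 0 < 8%:R * k ^+ 2 by rewrite mulr_gt0 ?exprn_gt0 // ltr0n.
have kneq : k != 0 by rewrite gt_eqF.
have cneq : c%:R != 0 :> F by rewrite gt_eqF.
have dneq : delta%:R != 0 :> F by rewrite gt_eqF.
have half1 : 2%:R * k * k * (tau * return_sum (m + m)) <= 4%:R^-1 * return_sum n.
  have -> : 2%:R * k * k * (tau * return_sum (m + m)) = 4%:R^-1 * (rho * return_sum (m + m)).
    by rewrite /tau; field.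
  by rewrite ler_wpM2l ?invr_ge0 ?ler0n.
have half2 : 2%:R * k * k * (s%:R / delta%:R / tau) <= 2%:R^-1.
  have -> : 2%:R * k * k * (s%:R / delta%:R / tau) = (16%:R * k ^+ 4 * s%:R) / c%:R.
    by rewrite /tau /rho; field; rewrite ?kneq ?cneq ?dneq.
  rewrite ler_pdivrMr // [leRHS]mulrC ler_pdivlMr ?ltr0n // kE -natrX -!natrM ler_nat.
  by rewrite cE mulnAC (mulnAC 16 _ 2) leq_addr.
have := ler_wpM2r (le_trans ler01 ge1) half2.
move: bound half1; rewrite mulrDr mulrA; lra.
Qed.

End RandomWalk.

(* A set S maximising e(S) + 2 delta |~: S| spans a subgraph of minimum degree
   at least delta. *)
Lemma min_deg_subset (T : finType) (e : rel T) (delta : nat) :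
  symmetric e ->
  (2 * delta * #|T| < #|[set xy : T * T | e xy.1 xy.2]|)%N ->
  exists S : {set T},
    (exists x y, [&& x \in S, y \in S & e x y]) /\
    forall x, x \in S -> (delta <= #|[pred y | [&& x \in S, y \in S & e x y]]|)%N.
Proof.
move=> e_sym dense.
pose E (S : {set T}) := [set xy : T * T | [&& xy.1 \in S, xy.2 \in S & e xy.1 xy.2]].
pose f (S : {set T}) := (#|E S| + 2 * delta * #|~: S|)%N.
pose S := [arg max_(S > setT) f S].
have fS : forall S', (f S' <= f S)%N.
  by rewrite /S; case: arg_maxnP => // S0 _ max S'; apply: max.
exists S; split.
  have : E S != set0.
    apply: contraTneq (fS setT) => E0.
    rewrite /f E0 cards0 add0n setCT cards0 muln0 addn0 -ltnNge.
    apply: leq_ltn_trans (leq_mul (leqnn _) (max_card _)) _.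
    apply: leq_trans dense _; apply: subset_leq_card.
    by apply/subsetP => xy; rewrite !inE.
  by case/set0Pn => -[x y]; rewrite inE => xyE; exists x, y.
move=> x xS; rewrite leqNgt; apply/negP => small.
(* Deleting [x] loses at most [2 * N] ordered edges, fewer than the [2 * delta] gained through the
   complement. *)
have := fS (S :\ x); rewrite leqNgt => /negP; apply.
set N := #|_| in small.
have E_le : (#|E S| <= #|E (S :\ x)| + 2 * N)%N.
  pose A := [set y | [&& x \in S, y \in S & e x y]].
  have NA : N = #|A| by rewrite cardsE.
  have /subset_leq_card : E S \subset
      E (S :\ x) :|: ((fun y => (x, y)) @: A :|: (fun y => (y, x)) @: A).
    apply/subsetP => -[y z]; rewrite !inE /= => /and3P[yS zS eyz].
    rewrite yS zS eyz /= andbT.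
    case: eqVneq => [yx|ynx] /=.
      apply/orP; left; apply/imsetP; exists z; last by rewrite yx.
      by rewrite inE xS zS -yx eyz.
    case: eqVneq => [zx|//] /=.
    apply/orP; right; apply/imsetP; exists y; last by rewrite zx.
    by rewrite inE xS yS -zx e_sym.
  move/leq_trans; apply; apply: leq_trans (leq_card_setU _ _) _.
  rewrite leq_add2l; apply: leq_trans (leq_card_setU _ _) _.
  by rewrite mul2n -addnn NA leq_add ?leq_imset_card.
have C_eq : #|~: (S :\ x)| = #|~: S|.+1.
  have := cardsC S; rewrite -(cardsC (S :\ x)) (cardsD1 x S) xS; lia.
rewrite /f C_eq; lia.
Qed.

(** The dense subgraph keeps the vertex type [T], the vertices outside [S] becoming isolated; this
    is why the random walk above allows isolated vertices. *)
Lemma nonsimilar_cycle (T : finType) (e sim : rel T) (s delta m : nat) :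
  symmetric e -> symmetric sim ->
  (forall u v, #|[pred w | e v w && sim u w]| <= s)%N ->
  ((32 * m.+1 ^ 4 * s + 1) ^ m.+1 * #|T| <= delta ^ m.+1)%N ->
  (2 * delta * #|T| < #|[set xy : T * T | e xy.1 xy.2]|)%N ->
  exists q, [/\ size q = (m.+1 + m.+1)%N, cycle e q &
                pairwise (fun x y => ~~ sim x y) q].
Proof.
move=> e_sym sim_sym sim_bound large dense.
have [S [[x [y xyS]] S_deg]] := min_deg_subset e_sym dense.
pose e' : rel T := fun x y => [&& x \in S, y \in S & e x y].
have e'_sym : symmetric e' by move=> u v; rewrite /e' e_sym andbCA.
have delta0 : (0 < delta)%N.
  have T0 : (0 < #|T|)%N by apply/card_gt0P; exists x.
  case: delta large {dense S_deg} => // /(leq_trans _).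
  by rewrite exp0n // => /(_ 1%N); rewrite muln_gt0 T0 expn_gt0 addn1 => /(_ isT).
have [u v|u v /and3P[uS _ _]||q [sq cq pq]] :=
  @nonsimilar_cycle_min_deg rat T e' e'_sym sim s delta sim_sym _ delta0 _ m _ large.
- apply: leq_trans (sim_bound u v); apply: subset_leq_card.
  by apply/subsetP => w; rewrite !inE => /andP[/and3P[_ _ ->]].
- exact: S_deg.
- by exists x, y.
exists q; split=> //; apply: sub_cycle cq => u v.
by case/and3P.
Qed.

(** * The energy graph of a colouring *)

Lemma superset_of_card (T : finType) (U : {set T}) p :
  #|U| <= p <= #|T| -> exists2 S : {set T}, U \subset S & #|S| = p.
Proof.
elim: p => [|p IHp] /andP[Up pT].
  by exists U => //; apply/eqP; rewrite -leqn0.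
move: Up; rewrite leq_eqVlt ltnS => /orP[/eqP <-|Up]; first by exists U.
have [|S US Sp] := IHp; first by rewrite Up ltnW.
have /set0Pn[x xS] : ~: S != set0 by rewrite -card_gt0; move: (cardsC S); lia.
by exists (x |: S); [rewrite subsetU ?US ?orbT | rewrite cardsU1 Sp -in_setC xS].
Qed.

Lemma leq_card_bigcup (I T : finType) (P : pred I) (A : I -> {set T}) :
  #|\bigcup_(i | P i) A i| <= \sum_(i | P i) #|A i|.
Proof.
elim/big_rec2: _ => [|i m B _ le]; first by rewrite cards0.
by apply: leq_trans (leq_card_setU _ _) _; rewrite leq_add2l.
Qed.

Section Colouring.
Variables (n c : nat) (col : {ffun 'I_n * 'I_n -> 'I_c}).

(** Sorting the endpoints matters because [col] is meaningful only on increasing pairs. *)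
Definition edge (x y : 'I_n) : 'I_n * 'I_n := if x < y then (x, y) else (y, x).
Definition colour x y := col (edge x y).

Lemma edgeC x y : edge x y = edge y x.
Proof.
rewrite /edge; case: ltngtP => // /val_inj ->.
by [].
Qed.

Lemma edge_inj x y x' y' :
  edge x y = edge x' y' -> (x = x' /\ y = y') \/ (x = y' /\ y = x').
Proof. by rewrite /edge; do 2![case: ifP => _] => -[-> ->]; auto. Qed.

(** Edges of [S] outside the given family contribute at most one colour each. *)
Lemma edge_colours_le (J : finType) (a b : J -> 'I_n) (S : {set 'I_n}) :
  (forall j, a j \in S) -> (forall j, b j \in S) -> (forall j, a j != b j) ->
  injective (fun j => edge (a j) (b j)) ->
  #|edge_colours col S| + #|J| <=
    'C(#|S|, 2) + #|[set colour (a j) (b j) | j : J]|.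
Proof.
move=> aS bS ab inj_ab.
pose P := [set xy : 'I_n * 'I_n | [&& xy.1 \in S, xy.2 \in S & xy.1 < xy.2]].
pose E := [set edge (a j) (b j) | j : J].
have EP : E \subset P.
  apply/subsetP => _ /imsetP[j _ ->]; rewrite inE /edge; case: ifP => /= lt.
    by rewrite aS bS lt.
  by rewrite aS bS ltn_neqAle leqNgt lt andbT eq_sym; apply: ab.
have cardP : #|P| <= 'C(#|S|, 2).
  rewrite -cards_draws.
  pose f (xy : 'I_n * 'I_n) := [set xy.1; xy.2].
  have f_inj : {in P &, injective f}.
    move=> [x y] [x' y']; rewrite !inE /= => /and3P[_ _ xy] /and3P[_ _ xy'].
    rewrite /f /= => eq_f.
    have: x \in [set x'; y'] by rewrite -eq_f set21.
    have: y \in [set x'; y'] by rewrite -eq_f set22.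
    have: y' \in [set x; y] by rewrite eq_f set22.
    rewrite !inE -!val_eqE /= => y'E yE xE.
    have [] : (x = x' :> nat) /\ (y = y' :> nat). by lia.
    by move=> /val_inj -> /val_inj ->.
  rewrite -(card_in_imset f_inj); apply: subset_leq_card.
  apply/subsetP => _ /imsetP[[x y] /[!inE]/= /and3P[xS yS xy] ->].
  rewrite /f cards2 subUset !sub1set xS yS /=.
  by have -> : x != y by apply: contraTneq xy => ->; rewrite ltnn.
have -> : edge_colours col S = col @: P.
  apply/setP => g; apply/imset2P/imsetP.
    move=> [x y xS /[!inE] /andP[yS xy] ->]; exists (x, y) => //.
    by rewrite inE /= xS yS.
  by move=> [[x y] /[!inE] /= /and3P[xS yS xy] ->]; exists x y; rewrite ?inE ?yS.
have -> : [set colour (a j) (b j) | j : J] = col @: E.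
  by rewrite /E -imset_comp.
have -> : #|J| = #|E| by rewrite card_imset.
have -> : P = P :\: E :|: E by rewrite setUC -[LHS](setID P E) (setIidPr EP).
rewrite imsetU.
have cU : #|col @: (P :\: E) :|: col @: E| <= #|P :\: E| + #|col @: E|.
  by apply: leq_trans (leq_card_setU _ _) _; rewrite leq_add2r leq_imset_card.
have EP_card : #|E| + #|P :\: E| = #|P| by rewrite -(cardsID E P) (setIidPr EP).
rewrite -(leq_add2r #|P :\: E|) -addnA EP_card.
rewrite [leqRHS]addnAC -[leqRHS]addnA; apply: leq_trans (leq_add cU cardP) _.
by rewrite addnC [X in _ + X]addnC.
Qed.

Section FewRepetitions.
Variables (p D : nat).
Hypothesis col_good :
  forall S : {set 'I_n}, #|S| = p -> 'C(p, 2) - D + 1 <= #|edge_colours col S|.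
Hypothesis le_pn : p <= n.

(** Enlarge the spanned vertex set to exactly [p] vertices and compare the guaranteed number of
    colours with [edge_colours_le]. *)
Lemma colour_repetitions (J : finType) (a b : J -> 'I_n) :
  (forall j, a j != b j) -> injective (fun j => edge (a j) (b j)) ->
  #|[set a j | j : J] :|: [set b j | j : J]| <= p ->
  #|J| < D + #|[set colour (a j) (b j) | j : J]|.
Proof.
move=> ab inj_ab ab_p.
have [|S /subsetP abS Sp] := @superset_of_card _ ([set a j | j : J] :|: [set b j | j : J]) p.
  by rewrite ab_p card_ord.
have aS j : a j \in S by apply: abS; rewrite inE imset_f.
have bS j : b j \in S by apply: abS; rewrite inE imset_f ?orbT.
have := leq_trans (leq_add (col_good Sp) (leqnn _)) (edge_colours_le aS bS ab inj_ab).
rewrite Sp; lia.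
Qed.

(** A star of [D.+1] edges in colour [g] has [D.+2 <= p] vertices, and [colour_repetitions] would
    give D + 1 < D + 1. *)
Lemma colour_degree v g : D.+2 <= p ->
  #|[pred w | (v != w) && (colour v w == g)]| <= D.
Proof.
move=> Dp; rewrite leqNgt; apply/negP => gtD.
set N := [pred w | _] in gtD.
pose b (j : 'I_D.+1) := enum_val (widen_ord gtD j).
have b_inj : injective b by move=> i j /enum_val_inj /(congr1 val) /= /val_inj.
have bN j : (v != b j) && (colour v (b j) == g) by apply: (enum_valP (widen_ord gtD j)).
have ab j : v != b j by have /andP[] := bN j.
have inj_ab : injective (fun j => edge v (b j)).
  move=> i j /edge_inj[] []; first by move=> _ /b_inj.
  by move=> vb; case/negP: (ab j); rewrite -vb.
have star : #|[set v | j : 'I_D.+1] :|: [set b j | j : 'I_D.+1]| <= p.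
  apply: leq_trans (leq_card_setU _ _) _; apply: leq_trans _ Dp.
  apply: (@leq_add _ _ 1 D.+1); last by rewrite (leq_trans (leq_imset_card _ _)) ?card_ord.
  by rewrite -(cards1 v); apply/subset_leq_card/subsetP => _ /imsetP[_ _ ->]; rewrite inE.
have mono : #|[set colour v (b j) | j : 'I_D.+1]| <= 1.
  rewrite -(cards1 g); apply/subset_leq_card/subsetP => _ /imsetP[j _ ->].
  by rewrite inE; have /andP[] := bN j.
have := leq_trans (colour_repetitions ab inj_ab star) (leq_add (leqnn D) mono).
by rewrite card_ord addn1 ltnn.
Qed.
End FewRepetitions.

(** * The energy graph on r-tuples: degrees and number of edges *)

Variable r' : nat.
Let r := r'.+1.

(** [X] and [Y] may share vertices in different coordinates; disjointness comes later from
    [share_vertex]. Since [r] is a successor, coordinate [ord0] can name the common colour. *)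
Definition energy_edge (X Y : {ffun 'I_r -> 'I_n}) :=
  [&& injectiveb X, injectiveb Y, [forall i, X i != Y i] &
      [forall i, colour (X i) (Y i) == colour (X ord0) (Y ord0)]].

Definition share_vertex (X Y : {ffun 'I_r -> 'I_n}) := [exists i, exists j, X i == Y j].

Lemma colourC x y : colour x y = colour y x.
Proof. by rewrite /colour edgeC. Qed.

Lemma energy_edge_sym : symmetric energy_edge.
Proof.
move=> X Y; rewrite /energy_edge andbCA; congr [&& _, _, _ & _].
  by apply: eq_forallb => i; rewrite eq_sym.
by apply: eq_forallb => i; rewrite !(colourC (Y _)).
Qed.

Lemma share_vertex_sym : symmetric share_vertex.
Proof.
by move=> X Y; apply/existsP/existsP => -[i /existsP[j ij]]; exists j;
  apply/existsP; exists i; rewrite eq_sym.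
Qed.

Section BoundedDegree.
Variable D : nat.
Hypothesis deg_le : forall v g, #|[pred w | (v != w) && (colour v w == g)]| <= D.

(** If [W j = U i], the common colour is that of [V j] and [U i]; each [W l] is then one of at most
    [D] neighbours of [V l] in this colour. *)
Lemma share_vertex_bound U V :
  #|[pred W | energy_edge V W && share_vertex U W]| <= r * r * D ^ r.
Proof.
pose N g v := [pred w | (v != w) && (colour v w == g)].
pose B (ij : 'I_r * 'I_r) :=
  [set W : {ffun 'I_r -> 'I_n} in family (fun l => N (colour (V ij.2) (U ij.1)) (V l))].
apply: leq_trans (_ : #|\bigcup_(ij : 'I_r * 'I_r) B ij| <= _).
  apply/subset_leq_card/subsetP => W; rewrite inE => /andP[/and4P[_ _ /forallP ne /forallP mono]].
  case/existsP=> i /existsP[j /eqP UW]; apply/bigcupP; exists (i, j) => //.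
  rewrite inE; apply/familyP => l; rewrite inE /= ne UW.
  by rewrite (eqP (mono l)) (eqP (mono j)) eqxx.
apply: leq_trans (leq_card_bigcup _ _) _.
apply: leq_trans (_ : \sum_(ij : 'I_r * 'I_r) D ^ r <= _).
  apply: leq_sum => ij _; rewrite cardsE card_family.
  have -> : D ^ r = D ^ size (enum 'I_r) by rewrite size_enum_ord.
  rewrite /image_mem; elim: (enum 'I_r) => [|l ls IH]; first by [].
  by rewrite expnS; apply: leq_mul (deg_le _ _) IH.
by rewrite sum_nat_const card_prod card_ord.
Qed.

Definition colour_class g :=
  [set xy : 'I_n * 'I_n | (xy.1 != xy.2) && (colour xy.1 xy.2 == g)].

(** Such a set is the graph of a partial injection, so distinct pairs chosen from it have injective
    tuples of first and of second endpoints. *)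
Definition bi_injective (A : {set 'I_n * 'I_n}) :=
  [forall a in A, forall b in A, ((a.1 == b.1) || (a.2 == b.2)) ==> (a == b)].

Lemma bi_injectiveP (A : {set 'I_n * 'I_n}) : reflect
  (forall a b, a \in A -> b \in A -> a.1 = b.1 \/ a.2 = b.2 -> a = b)
  (bi_injective A).
Proof.
apply: (iffP forall_inP) => [inj a b aA bA ab|inj a aA].
  have /forall_inP/(_ b bA)/implyP := inj a aA.
  by case: ab => -> /(_ _)/eqP -> //; rewrite eqxx ?orbT.
apply/forall_inP => b bA; apply/implyP => ab; apply/eqP/inj => //.
by case/orP: ab => /eqP; auto.
Qed.

(* A maximal set of edges of one colour with distinct first and distinct second
   endpoints meets every edge of that colour. *)
Lemma bi_injective_subset g : exists2 A : {set 'I_n * 'I_n},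
  A \subset colour_class g /\ bi_injective A & #|colour_class g| <= 2 * D * #|A|.
Proof.
pose P (A : {set 'I_n * 'I_n}) := (A \subset colour_class g) && bi_injective A.
have P0 : P set0.
  by rewrite /P sub0set; apply/bi_injectiveP => a b; rewrite inE.
case: (@arg_maxnP _ set0 P (fun A => #|A|) P0) => A /andP[AM injA] maxA.
exists A => //.
pose L (a : 'I_n * 'I_n) := [set xy in colour_class g | xy.1 == a.1].
pose R (a : 'I_n * 'I_n) := [set xy in colour_class g | xy.2 == a.2].
have cover : colour_class g \subset \bigcup_(a in A) (L a :|: R a).
  apply/subsetP => xy xyM; apply/bigcupP.
  have [/existsP[a /andP[aA axy]]|none] :=
      boolP [exists a : 'I_n * 'I_n, (a \in A) && ((xy.1 == a.1) || (xy.2 == a.2))].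
    by exists a; rewrite // !inE in xyM *; rewrite xyM.
  have none' a : a \in A -> (xy.1 == a.1) || (xy.2 == a.2) = false.
    move=> aA; apply: contraNF none => h; apply/existsP; exists a.
    by rewrite aA.
  have xyA : xy \notin A by apply/negP => /none'; rewrite eqxx.
  have /maxA : P (xy |: A).
    apply/andP; split; first by rewrite subUset sub1set xyM.
    apply/bi_injectiveP => a b; rewrite !inE.
    move=> /orP[/eqP->|aA] /orP[/eqP->|bA] // ab.
    - by move: (none' b bA); case: ab => ->; rewrite eqxx ?orbT.
    - by move: (none' a aA); case: ab => <-; rewrite eqxx ?orbT.
    - exact: (bi_injectiveP _ injA).
  by rewrite cardsU1 xyA /= add1n ltnn.
apply: leq_trans (subset_leq_card cover) _.
apply: leq_trans (leq_card_bigcup _ _) _.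
apply: leq_trans (_ : \sum_(a in A) 2 * D <= _); last by rewrite sum_nat_const mulnC.
apply: leq_sum => a _; apply: leq_trans (leq_card_setU _ _) _.
rewrite mul2n -addnn leq_add //.
  apply: leq_trans (deg_le a.1 g).
  have inj : {in L a &, injective snd}.
    by move=> [x y] [x' y']; rewrite !inE /= => /andP[_ /eqP->] /andP[_ /eqP->] ->.
  rewrite -(card_in_imset inj); apply/subset_leq_card/subsetP => _ /imsetP[[x y] xyT ->].
  by move: xyT; rewrite !inE /= => /andP[/andP[xy xyg] /eqP <-]; rewrite xy.
apply: leq_trans (deg_le a.2 g).
have inj : {in R a &, injective fst}.
  by move=> [x y] [x' y']; rewrite !inE /= => /andP[_ /eqP->] /andP[_ /eqP->] ->.
rewrite -(card_in_imset inj); apply/subset_leq_card/subsetP => _ /imsetP[[x y] xyT ->].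
by move: xyT; rewrite !inE /= => /andP[/andP[xy xyg] /eqP <-]; rewrite eq_sym xy colourC.
Qed.

Lemma sum_colour_class : \sum_g #|colour_class g| = n * n.-1.
Proof.
transitivity #|[set xy : 'I_n * 'I_n | xy.1 != xy.2]|.
  rewrite -sum1_card (partition_big (fun xy => colour xy.1 xy.2) predT) //=.
  by apply: eq_bigr => g _; rewrite -sum1_card; apply: eq_bigl => xy; rewrite !inE.
have := cardsC [set xy : 'I_n * 'I_n | xy.1 == xy.2].
have -> : ~: [set xy : 'I_n * 'I_n | xy.1 == xy.2] = [set xy | xy.1 != xy.2].
  by apply/setP => xy; rewrite !inE.
have -> : [set xy : 'I_n * 'I_n | xy.1 == xy.2] = (fun x => (x, x)) @: setT.
  apply/setP => -[x y]; rewrite inE /=.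
  by apply/eqP/imsetP => [->|[z _ [-> ->]]] //; exists y.
rewrite card_imset; last by move=> x y [].
by rewrite cardsT card_prod !card_ord -subn1 mulnBr muln1 => <-; rewrite addKn.
Qed.

(** A sequence of [r] distinct pairs in [A g] splits into an adjacent pair of tuples, from which the
    sequence and its colour [g] can be read off. *)
Lemma energy_edges_ge (A : 'I_c -> {set 'I_n * 'I_n}) :
  (forall g, A g \subset colour_class g) -> (forall g, bi_injective (A g)) ->
  \sum_g #|A g| ^_ r <=
    #|[set XY : {ffun 'I_r -> 'I_n} * {ffun 'I_r -> 'I_n} | energy_edge XY.1 XY.2]|.
Proof.
move=> sub inj.
pose B g := [set Z : {ffun 'I_r -> 'I_n * 'I_n} in ffun_on (mem (A g)) | injectiveb Z].
pose Q := [set gZ : 'I_c * {ffun 'I_r -> 'I_n * 'I_n} | gZ.2 \in B gZ.1].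
have -> : \sum_g #|A g| ^_ r = #|Q|.
  rewrite -sum1_card; under [RHS]eq_bigl do rewrite inE.
  rewrite -(pair_big_dep xpredT (fun g Z => Z \in B g) (fun _ _ => 1)) /=.
  apply: eq_bigr => g _; rewrite sum1_card.
  by rewrite /B -[in LHS](card_ord r) -card_inj_ffuns_on.
pose f (gZ : 'I_c * {ffun 'I_r -> 'I_n * 'I_n}) :=
  ([ffun i => (gZ.2 i).1], [ffun i => (gZ.2 i).2]).
have QP g Z : (g, Z) \in Q -> injective Z /\ forall i, Z i \in A g.
  by rewrite !inE => /andP[/ffun_onP ZA /injectiveP Zinj].
have AP g xy : xy \in A g -> xy.1 != xy.2 /\ colour xy.1 xy.2 = g.
  by move/(subsetP (sub g)); rewrite inE => /andP[? /eqP].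
have f_inj : {in Q &, injective f}.
  move=> [g Z] [g' Z'] /QP[_ ZA] /QP[_ ZA'] [/ffunP e1 /ffunP e2].
  have eZ : Z = Z'.
    apply/ffunP => i; move: (e1 i) (e2 i); rewrite !ffunE.
    by case: (Z i) (Z' i) => ? ? [? ?] /= -> ->.
  have [_ <-] := AP _ _ (ZA ord0); have [_ <-] := AP _ _ (ZA' ord0).
  by rewrite eZ.
rewrite -(card_in_imset f_inj); apply/subset_leq_card/subsetP => _ /imsetP[[g Z] gZ ->].
have [Zinj ZA] := QP _ _ gZ; rewrite inE /= /energy_edge.
apply/and4P; split.
- apply/injectiveP => i j; rewrite !ffunE => eq1; apply: Zinj.
  by apply: (bi_injectiveP _ (inj g)); auto.
- apply/injectiveP => i j; rewrite !ffunE => eq2; apply: Zinj.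
  by apply: (bi_injectiveP _ (inj g)); auto.
- by apply/forallP => i; rewrite !ffunE; have [] := AP _ _ (ZA i).
- apply/forallP => i; rewrite !ffunE.
  by have [_ ->] := AP _ _ (ZA i); have [_ ->] := AP _ _ (ZA ord0).
Qed.

(** Threshold form of the power-mean step, with a = [#|A g|]. If a <= t, then t^(r-1) a <= t^r. If a
    > t >= 2r, the falling factorial is at least (a - r)^r >= (a/2)^r. *)
Lemma energy_edges_lower t : 2 * r <= t ->
  t ^ r' * (n * n.-1) <= 2 * D * (2 ^ r *
    #|[set XY : {ffun 'I_r -> 'I_n} * {ffun 'I_r -> 'I_n} | energy_edge XY.1 XY.2]|
    + c * t ^ r).
Proof.
move=> tr.
have [A] := fin_all_exists2 bi_injective_subset.
move=> subA cardA.
apply: leq_trans (_ : t ^ r' * \sum_g (2 * D * #|A g|) <= _).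
  by rewrite leq_mul2l -sum_colour_class leq_sum ?orbT.
rewrite -big_distrr /= mulnCA leq_mul2l; apply/orP; right.
apply: leq_trans (_ : \sum_g (2 ^ r * #|A g| ^_ r + t ^ r) <= _); last first.
  rewrite big_split sum_nat_const card_ord -big_distrr /= leq_add2r leq_mul2l.
  by rewrite energy_edges_ge ?orbT // => g; case: (subA g).
rewrite big_distrr; apply: leq_sum => g _ /=.
have [le|gt] := leqP #|A g| t.
  by apply: leq_trans (leq_addl _ _); rewrite expnSr leq_mul2l le orbT.
apply: leq_trans (leq_addr _ _).
apply: leq_trans (_ : #|A g| ^ r <= _).
  rewrite expnSr leq_mul2r; apply/orP; right.
  by have [->|r'0] := posnP r'; rewrite // leq_exp2r // ltnW.
have ffact_ge a l : (a - l) ^ l <= a ^_ l.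
  elim: l a => [|l IHl] [|a] //=; first by rewrite sub0n exp0n.
  rewrite ffactnS expnS subSS leq_mul ?IHl // leq_subLR; lia.
apply: leq_trans (leq_mul (leqnn _) (ffact_ge _ _)).
rewrite -expnMn leq_exp2r // mulnBr [2 * #|_|]mul2n -addnn -addnBA ?leq_addr //.
by rewrite ltnW // (leq_ltn_trans tr).
Qed.
End BoundedDegree.

(* The coordinates of the cycle span p vertices and p edges, which receive only
   one colour for each of the edges of the cycle. *)
Lemma no_nonsimilar_cycle p D m q :
  (forall S : {set 'I_n}, #|S| = p -> 'C(p, 2) - D + 1 <= #|edge_colours col S|) ->
  p <= n -> size q = m.+2 + m.+2 -> p = (m.+2 + m.+2) * r ->
  D = r' * (m.+2 + m.+2) -> cycle energy_edge q ->
  pairwise (fun X Y => ~~ share_vertex X Y) q -> False.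
Proof.
move=> col_good le_pn; case: q => // X0 q sq pE DE cq pq; pose l := m.+2 + m.+2; pose Q := X0 :: q.
pose x (i : 'I_l) := nth X0 Q i.
have x_edge i : energy_edge (x i) (x (ordS i)).
  have lE : (size q).+1 = l by [].
  have iq : i <= size q by rewrite -ltnS lE.
  have := pathP X0 cq i; rewrite size_rcons ltnS iq -rcons_cons !nth_rcons /= ltnS iq => /(_ isT).
  have sE : ordS i = i.+1 %% (size q).+1 :> nat by rewrite lE.
  rewrite /x sE; move: iq; rewrite leq_eqVlt => /orP[/eqP ->|lt].
    by rewrite ltnn eqxx modnn.
  by rewrite lt modn_small.
have x_inj i : injective (x i) by have /and4P[/injectiveP] := x_edge i.
have nonsim (i i' : 'I_l) : i < i' -> ~~ share_vertex (x i) (x i').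
  by move=> lt; apply: (pairwiseP X0 pq); rewrite // inE sq.
have v_inj i i' j j' : x i j = x i' j' -> i = i' /\ j = j'.
  have [lt|lt|/val_inj <- /x_inj //] := ltngtP i i' => eqx.
    by case/negP: (nonsim _ _ lt); apply/existsP; exists j; apply/existsP; exists j'; apply/eqP.
  by case/negP: (nonsim _ _ lt); apply/existsP; exists j'; apply/existsP; exists j; apply/eqP.
pose a (ij : 'I_l * 'I_r) := x ij.1 ij.2.
pose b (ij : 'I_l * 'I_r) := x (ordS ij.1) ij.2.
have ab ij : a ij != b ij by have /and4P[_ _ /forallP-/(_ ij.2)] := x_edge ij.1.
have inj_ab : injective (fun ij => edge (a ij) (b ij)).
  move=> [i j] [i' j'] /edge_inj[] [/v_inj[/= e1 e2] /v_inj[/= e3 e4]]; first by rewrite e1 e2.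
  (* Equality with endpoints swapped forces i' + 2 = i' modulo [l], impossible because [l] is at
     least 4. *)
  have := congr1 val e3; rewrite e1 /= -addn1 modnDml addn1 => h.
  have := divn_eq i'.+2 l; rewrite h; case: (_ %/ _) => [|d]; first lia.
  by rewrite mulSn /l; lia.
have ab_p : #|[set a j | j : 'I_l * 'I_r] :|: [set b j | j : 'I_l * 'I_r]| <= p.
  have /setUidPl-> : [set b j | j : 'I_l * 'I_r] \subset [set a j | j : 'I_l * 'I_r].
    by apply/subsetP => _ /imsetP[ij _ ->]; apply/imsetP; exists (ordS ij.1, ij.2).
  by apply: leq_trans (leq_imset_card _ _) _; rewrite card_prod !card_ord pE.
have mono : #|[set colour (a j) (b j) | j : 'I_l * 'I_r]| <= l.
  rewrite -[leqRHS]card_ord -(cardsT 'I_l).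
  apply: leq_trans (_ : #|[set colour (x i ord0) (x (ordS i) ord0) | i in [set: 'I_l]]| <= _).
    apply/subset_leq_card/subsetP => _ /imsetP[ij _ ->]; apply/imsetP; exists ij.1; rewrite ?inE //.
    by have /and4P[_ _ _ /forallP/(_ ij.2)/eqP] := x_edge ij.1.
  exact: leq_imset_card.
(* There are l r edges, but at most [l] colours allow fewer than [D + l], which is also l r. *)
have := leq_trans (colour_repetitions col_good le_pn ab inj_ab ab_p) (leq_add (leqnn D) mono).
by rewrite card_prod !card_ord DE /r mulnS -/l mulnC addnC ltnn.
Qed.
End Colouring.

(** * Lower bound on the number of colours *)

(** More than [2 * delta * n ^ r] ordered energy edges would force a forbidden cycle; this upper
    bound is set against [energy_edges_lower]. *)
Lemma energy_bound r' m n c (col : {ffun 'I_n * 'I_n -> 'I_c}) t delta :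
  let r := r'.+1 in let k := m.+2 in let p := (k + k) * r in
  let D := r' * (k + k) in
  let s := r * r * D ^ r in
  0 < r' -> p <= n ->
  (forall S : {set 'I_n}, #|S| = p -> 'C(p, 2) - D + 1 <= #|edge_colours col S|) ->
  2 * r <= t -> 8 * D * c * t <= n ^ 2 ->
  (32 * k ^ 4 * s + 1) ^ k * n ^ r <= delta ^ k ->
  t ^ r' * n ^ 2 <= 2 ^ (r + 4) * D * (delta * n ^ r).
Proof.
move=> r k p D s r'0 pn good rt ct large.
have Dp : D.+2 <= p by rewrite /D /p /r /k mulnS; lia.
have D0 : 0 < D by rewrite muln_gt0 r'0.
have deg_le v g := colour_degree good pn v g Dp.
pose E := #|[set XY | @energy_edge n c col r' XY.1 XY.2]|.
have sparse : E <= 2 * delta * n ^ r.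
  rewrite leqNgt; apply/negP => dense.
  have cardT : #|{ffun 'I_r -> 'I_n}| = n ^ r by rewrite card_ffun !card_ord.
  have [|||q [sq cq pq]] := @nonsimilar_cycle _ _ (@share_vertex n r') s delta m.+1
    (@energy_edge_sym n c col r') (@share_vertex_sym n r').
  - by move=> U V; apply: share_vertex_bound deg_le U V.
  - by rewrite cardT.
  - by rewrite cardT.
  exact: (no_nonsimilar_cycle good pn sq erefl erefl cq pq).
have lower := energy_edges_lower deg_le rt.
rewrite -/E -/r in lower.
have n2 : 2 <= n by apply: leq_trans pn; rewrite /p /k; nia.
have nn : n ^ 2 <= 2 * (n * n.-1) by case: (n) n2 => // n' ; rewrite -mulnn /=; nia.
pose u := t ^ r'.
have tE : t ^ r = u * t by rewrite expnSr.
(* The condition on [c * t] makes the classes below the threshold account for at most half of the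
   total. *)
have half : 2 * (2 * D * (c * t ^ r)) <= u * (n * n.-1).
  have -> : 2 * (2 * D * (c * t ^ r)) = u * (4 * D * c * t) by rewrite tE; lia.
  rewrite leq_mul2l; apply/orP; right; lia.
have key : u * (n * n.-1) <= 2 * (2 * D * (2 ^ r * E)).
  by move: lower half; rewrite -/u mulnDr; lia.
apply: leq_trans (_ : 2 * (u * (n * n.-1)) <= _).
  by rewrite mulnCA leq_mul2l nn orbT.
apply: leq_trans (leq_mul (leqnn 2) key) _.
apply: leq_trans (_ : 2 * (2 * (2 * D * (2 ^ r * (2 * delta * n ^ r)))) <= _).
  by rewrite !leq_mul2l sparse !orbT.
by rewrite expnD; apply: eq_leq; lia.
Qed.

(** The least admissible [d] is at least 2, so d <= 2(d - 1), while (d - 1)^k < a. *)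
Lemma root_approx k a : 0 < k -> 1 < a ->
  exists2 d, a <= d ^ k & d ^ k <= 2 ^ k * a.
Proof.
move=> k0 a1.
have ex : exists d, a <= d ^ k.
  by exists a; rewrite -[leqLHS]expn1 leq_pexp2l // ltnW.
case: (ex_minnP ex) => d ad min; exists d => //.
have d2 : 1 < d.
  by case: d ad {min} => [|[|d]] //; rewrite ?exp0n ?exp1n //; lia.
have lt : d.-1 ^ k < a by rewrite ltnNge; apply/negP => /min; lia.
apply: leq_trans (leq_mul (leqnn _) (ltnW lt)).
by rewrite -expnMn leq_exp2r //; lia.
Qed.

(** Take [t] about n^2 / (8Dc) and [delta] about a n^(r/k) in [energy_bound], then raise to the
    power [k] to stay within integers. *)
Lemma colours_lower_bound r' m : 0 < r' -> exists2 K, 0 < K &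
  forall n c, 2 * m.+2 * r'.+1 <= n ->
  good_colouring n (2 * m.+2 * r'.+1)
    ('C(2 * m.+2 * r'.+1, 2) - r' * (2 * m.+2) + 1) c ->
  n ^ (r'.+1 * m.+1) <= K * c ^ (r' * m.+2).
Proof.
move=> r'0; pose r := r'.+1; pose k := m.+2; pose D := r' * (k + k).
pose a := 32 * k ^ 4 * (r * r * D ^ r) + 1.
have D0 : 0 < D by rewrite muln_gt0 r'0.
have a1 : 1 < a.
  by rewrite /a addn1 ltnS; rewrite !muln_gt0 !expn_gt0 D0.
pose K1 := 2 ^ (r + 4) * D.
have K1_gt0 : 0 < K1 by rewrite muln_gt0 expn_gt0.
exists ((16 * r * D) ^ (r' * k) * (2 * K1 * a) ^ k).
  by rewrite muln_gt0 !expn_gt0 !muln_gt0 r'0 !expn_gt0 (ltnW a1) ?orbT.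
rewrite -/r -/k mul2n -addnn => n c pn.
case/existsP=> col /forallP good.
have good' (S : {set 'I_n}) : #|S| = (k + k) * r ->
    'C((k + k) * r, 2) - D + 1 <= #|edge_colours col S|.
  by move=> Sp; have /implyP := good S; apply; apply/eqP.
have n2 : 2 <= n by apply: leq_trans pn; rewrite /k /r; nia.
have c0 : 0 < c.
  have := col (Ordinal n2, Ordinal n2); case: (c) => // [[]] //.
pose t := n ^ 2 %/ (8 * D * c).
have den0 : 0 < 8 * D * c by rewrite !muln_gt0 r'0 c0.
have nt : n ^ 2 < t.+1 * (8 * D * c) by apply: ltn_ceil.
(* If [t] is below [2 * r], then [c] is already quadratic in [n], and 2(r-1)k >= r(k-1) suffices. *)
have [ge|lt] := leqP (2 * r) t; last first.
  apply: leq_trans (_ : (n ^ 2) ^ (r' * k) <= _).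
    by rewrite -expnM leq_pexp2l ?(ltnW n2) // /r /k; nia.
  apply: leq_trans (_ : (16 * r * D * c) ^ (r' * k) <= _).
    rewrite leq_exp2r ?muln_gt0 ?r'0 //; apply: leq_trans (ltnW nt) _.
    apply: leq_trans (leq_mul lt (leqnn _)) _; apply: eq_leq; lia.
  rewrite expnMn leq_mul2r; apply/orP; right; apply: leq_pmulr.
  by rewrite expn_gt0 !muln_gt0 r'0 !expn_gt0 (ltnW a1).
have [|d d_ge d_le] := @root_approx k (a ^ k * n ^ r) isT.
  apply: (@leq_trans (a ^ k)); first by rewrite -(exp1n k) ltn_exp2r.
  by rewrite leq_pmulr // expn_gt0 (ltnW n2).
have ct : 8 * D * c * t <= n ^ 2 by rewrite mulnC leq_trunc_div.
have := energy_bound r'0 pn good' ge ct d_ge.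
rewrite -/K1 -/r => key.
have t0 : 0 < t by apply: leq_trans ge.
have n0 : 0 < n by apply: ltnW.
have tn : n ^ 2 <= 16 * r * D * c * t.
  apply: leq_trans (ltnW nt) _; apply: leq_trans (_ : 2 * t * (8 * D * c) <= _).
    by rewrite leq_mul2r; apply/orP; right; lia.
  by rewrite -!mulnA /r; nia.
have keyk : t ^ (r' * k) * n ^ (2 * k) <= (2 * K1 * a) ^ k * (n ^ r * n ^ (r * k)).
  rewrite !expnM -expnMn; apply: leq_trans (_ : (K1 * (d * n ^ r)) ^ k <= _).
    by rewrite leq_exp2r.
  rewrite !expnMn; apply: leq_trans (leq_mul (leqnn _) (leq_mul d_le (leqnn _))) _.
  by apply: eq_leq; ring.
have tnk : n ^ (2 * (r' * k)) <= (16 * r * D) ^ (r' * k) * c ^ (r' * k) * t ^ (r' * k).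
  by rewrite -!expnMn expnM leq_exp2r ?muln_gt0 ?r'0.
have n_split : n ^ (2 * (r' * k)) * n ^ (2 * k) = n ^ (r * m.+1) * (n ^ r * n ^ (r * k)).
  by rewrite -!expnD; congr (n ^ _); rewrite /r /k; lia.
have nn0 : 0 < n ^ r * n ^ (r * k) by rewrite muln_gt0 !expn_gt0 n0.
(* Chaining [tnk] with [keyk] eliminates the power of [t]; the exponent of [n] left over is 2rk - r
   - rk = r(k-1). *)
rewrite -(leq_pmul2r nn0) -n_split.
apply: leq_trans (leq_mul tnk (leqnn _)) _; rewrite -mulnA.
apply: leq_trans (leq_mul (leqnn _) keyk) _; apply: eq_leq; ring.
Qed.

Lemma g_lower_bound r' m : 0 < r' -> exists2 K, 0 < K &
  forall n, 2 * m.+2 * r'.+1 <= n ->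
  n ^ (r'.+1 * m.+1) <= K * g n (2 * m.+2 * r'.+1)
    ('C(2 * m.+2 * r'.+1, 2) - r' * (2 * m.+2) + 1) ^ (r' * m.+2).
Proof.
move=> r'0; have [K K0 lower] := colours_lower_bound m r'0.
exists (K * 4 ^ (r' * m.+2)) => [|n pn]; first by rewrite muln_gt0 K0 expn_gt0.
set p := 2 * m.+2 * r'.+1 in pn lower *; set q := _ - _ + 1 in lower *.
have n2 : 2 <= n by apply: leq_trans pn; rewrite /p; nia.
rewrite -mulnA -expnMn /g; set G := find _ _.
have [found|notfound] := boolP (has (good_colouring n p q) (iota 0 ('C(n, 2)).+1)).
  have Gn : G < 'C(n, 2).+1 by rewrite -[X in _ < X](size_iota 0) -has_find.
  have := nth_find 0 found; rewrite nth_iota // => /(lower _ _ pn).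
  move/leq_trans; apply; rewrite leq_mul2l leq_exp2r ?muln_gt0 ?r'0 //.
  by rewrite leq_pmull ?orbT.
(* An unsuccessful [find] returns the length of the list, and 4('C(n, 2) + 1) >= n^2; this is the
   source of the factor 4. *)
have -> : G = 'C(n, 2).+1.
  by move: notfound; rewrite has_find -leqNgt size_iota => ge;
    apply/eqP; rewrite eqn_leq ge andbT -[X in _ <= X](size_iota 0) find_size.
apply: leq_trans (leq_pmull _ K0).
apply: leq_trans (_ : (n ^ 2) ^ (r' * m.+2) <= _).
  by rewrite -expnM leq_pexp2l ?(ltnW n2) //; nia.
rewrite leq_exp2r ?muln_gt0 ?r'0 //.
by have := bin2_sum; rewrite bin2 -divn2; move: (n) n2 => n' n2; nia.
Qed.
(* Imported only here because it redefines ^ on nat as Nat.pow. *)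
From Stdlib Require Import Reals.

(** * Passage to real exponents *)

Lemma INR_expn a b : INR (expn a b) = (INR a ^ b)%R.
Proof. by elim: b => [|b IHb] //; rewrite expnS mult_INR IHb. Qed.

Lemma Rpower_le_root (x y : R) (a b : nat) :
  (0 < x)%R -> (0 < y)%R -> 0 < b -> (x ^ a <= y ^ b)%R ->
  (Rpower x (INR a / INR b) <= y)%R.
Proof.
move=> x0 y0 b0 le_xy; have b0' : (0 < INR b)%R by apply/lt_0_INR/ssrnat.ltP.
rewrite /Rdiv -Rpower_mult (Rpower_pow a x x0).
apply: Rle_trans (Rle_Rpower_l _ (y ^ b)%R _ _ _) _.
- exact/Rlt_le/Rinv_0_lt_compat.
- by split; [apply: pow_lt|].
rewrite -(Rpower_pow b y y0) Rpower_mult Rinv_r ?Rpower_1 //; first exact: Rle_refl.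
exact: Rgt_not_eq.
Qed.

Theorem theorem6p1 (r k : nat) (hr : (2 <= r)%N) (hk : (2 <= k)%N) :
  exists C : R, (0 < C)%R /\
    exists N : nat, forall n : nat, (N <= n)%N ->
      (C * Rpower (INR n) (INR r / INR (r - 1) * (INR (k - 1) / INR k))
        <= INR (g n (2 * k * r) ('C(2 * k * r, 2) - (r - 1) * (2 * k) + 1)))%R.
Proof.
case: r hr => [|[|r']] // _; case: k hk => [|[|m]] // _.
rewrite !subn1 [r'.+2.-1]/= [m.+2.-1]/=.
have [K K0 lower] := @g_lower_bound r'.+1 m isT.
have K0' : (0 < INR K)%R by apply/lt_0_INR/ssrnat.ltP.
(* For b >= 1, K G^b <= (K G)^b, so taking b-th roots costs only the factor [K]. *)
exists (/ INR K)%R; split; first exact: Rinv_0_lt_compat.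
exists (2 * m.+2 * r'.+2) => n pn; move: (lower n pn).
set G := g _ _ _ => le_nG.
have n0 : 0 < n by apply: leq_trans pn; rewrite !muln_gt0.
have G0 : 0 < G.
  rewrite lt0n; apply: contraTneq le_nG => ->.
  by rewrite exp0n ?muln_gt0 // muln0 -ltnNge expn_gt0 n0.
have root : (Rpower (INR n) (INR (r'.+2 * m.+1) / INR (r'.+1 * m.+2)) <= INR (K * G))%R.
  apply: Rpower_le_root => //; first exact/lt_0_INR/ssrnat.ltP.
    by apply/lt_0_INR/ssrnat.ltP; rewrite muln_gt0 K0.
  rewrite -!INR_expn; apply/le_INR/ssrnat.leP; apply: leq_trans le_nG _.
  rewrite expnMn leq_mul2r; apply/orP; right.
  by rewrite -[leqLHS]expn1 leq_pexp2l // muln_gt0.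
have -> : (INR r'.+2 / INR r'.+1 * (INR m.+1 / INR m.+2))%R =
    (INR (r'.+2 * m.+1) / INR (r'.+1 * m.+2))%R.
  by rewrite !mult_INR; field; split; apply: not_0_INR.
apply: (Rmult_le_reg_l (INR K)) => //.
by rewrite -mult_INR -Rmult_assoc Rinv_r ?Rmult_1_l //; apply: Rgt_not_eq.
Qed.
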